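(* $f(3,q)\ge q^{q-o(q)}$; that is, there is a function $g$ with $g(q)/q\to 0$ as $q\to\infty$ such that $f(3,q)\ge q^{q-g(q)}$ for all $q\ge 2$.
   Context: A word over an alphabet is a finite string of letters; a subword of $w$ is a string of consecutive letters of $w$. A word $w$ contains a pattern $P$ if there is a map assigning to each letter of $P$ a nonempty word (different letters may receive equal words) such that the word obtained from $P$ by replacing each letter by its assigned word is a subword of $w$. The Zimin word $Z_3$ is $x_1x_2x_1x_3x_1x_2x_1$. $f(3,q)$ denotes the smallest integer such that every word of length $f(3,q)$ over an alphabet of size $q$ contains $Z_3$. *)

(* Defs.v *)
From mathcomp Require Import all_boot all_order all_algebra.
From mathcomp Require Import boolp classical_sets reals topology normedtype.
From mathcomp Require Import sequences exp.

Set Implicit Arguments.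
Unset Strict Implicit.
Unset Printing Implicit Defensive.

(* [infix u w] is the library's "u is a string of consecutive letters of w". *)
Definition contains_pattern (V : eqType) (T : eqType) (P : seq V) (w : seq T)
    : Prop :=
  exists h : V -> seq T,
    (forall x, x \in P -> h x != [::]) /\ infix (flatten (map h P)) w.

(* The letter x_i is encoded as the natural number i. *)
Fixpoint zimin (n : nat) : seq nat :=
  if n is m.+1 then zimin m ++ n :: zimin m else [::].

Lemma zimin3E : zimin 3 = [:: 1; 2; 1; 3; 1; 2; 1].
Proof. by []. Qed.

Definition all_words_contain_zimin (n q L : nat) : Prop :=
  forall w : seq 'I_q, size w = L -> contains_pattern (zimin n) w.

Lemma mem_zimin_le n x : x \in zimin n -> x <= n.
Proof.
elim: n => [//|n IHn] /=.
rewrite mem_cat in_cons => /or3P[/IHn|/eqP->|/IHn] //; exact: leqW.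
Qed.

Lemma contains_zimin_step (T : eqType) n (a u v w c : seq T) :
    contains_pattern (zimin n) u -> v != [::] ->
    w = a ++ u ++ v ++ u ++ c ->
  contains_pattern (zimin n.+1) w.
Proof.
move=> [h [h0 /infixP[p [s Eu]]]] v0 ->.
pose h' x := if x == n.+1 then s ++ v ++ p else h x.
have h'E x : x \in zimin n -> h' x = h x.
  by move=> /mem_zimin_le xn; rewrite /h' ifN// neq_ltn ltnS xn.
exists h'; split.
  move=> x /=; rewrite mem_cat in_cons => /or3P[xn|/eqP->|xn].
  - by rewrite h'E// h0.
  - by rewrite /h' eqxx -!size_eq0 !size_cat !addn_eq0 (size_eq0 v) (negbTE v0)
      andbF.
  - by rewrite h'E// h0.
have -> : flatten (map h' (zimin n.+1)) =
    flatten (map h (zimin n)) ++ (s ++ v ++ p) ++ flatten (map h (zimin n)).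
  rewrite /= map_cat flatten_cat /=; have /eq_in_map -> := h'E.
  by rewrite /h' eqxx.
apply/infixP; exists (a ++ p), (s ++ c).
by rewrite Eu !catA.
Qed.

(* A word of length (q ^ L + 1)(L + 1) has two equal, non-adjacent blocks of
   length L. *)
Lemma zimin_unavoidable n q : exists L, all_words_contain_zimin n q L.
Proof.
elim: n => [|n [L HL]].
  by exists 0 => w _; exists (fun=> [::]); split => //=; exact: infix0s.
exists ((q ^ L).+1 * L.+1) => w sw.
pose B i := take L (drop (i * L.+1) w).
have room i : i < (q ^ L).+1 -> i * L.+1 + L.+1 <= size w.
  by move=> iN; rewrite sw addnC -mulSn leq_mul2r iN orbT.
have sB i : i < (q ^ L).+1 -> size (B i) = L.
  move=> /room r; rewrite size_takel// size_drop leq_subRL.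
    by rewrite (leq_trans _ r)// leq_add2l.
  by rewrite (leq_trans _ r)// leq_addr.
pose F (i : 'I_(q ^ L).+1) : L.-tuple 'I_q :=
  Tuple (introT eqP (sB i (ltn_ord i))).
have /injectivePn[i0 [j0 ne0 eF0]] : ~~ injectiveb F.
  apply/negP => /injectiveP/leq_card.
  by rewrite card_ord card_tuple card_ord ltnn.
have [i [j [ij jN eB]]] : exists i j, [/\ i < j, j < (q ^ L).+1 & B i = B j].
  have e : B i0 = B j0 := congr1 val eF0.
  case: (ltngtP i0 j0) => [lt|lt|/val_inj eq].
  - by exists i0, j0.
  - by exists j0, i0.
  - by rewrite eq eqxx in ne0.
have iN := ltn_trans ij jN.
pose d := j * L.+1 - i * L.+1.
have dE : j * L.+1 = d + i * L.+1 by rewrite subnK// leq_mul2r (ltnW ij) orbT.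
have dL : L < d by rewrite /d -mulnBl leq_pmull// subn_gt0.
pose W := drop (i * L.+1) w.
have EW : B j = take L (drop d W) by rewrite /B dE /W drop_drop.
have sW : d + L < size W.
  rewrite /W size_drop ltn_subRL addnA (addnC _ d) -dE -addnS; exact: room.
apply: (@contains_zimin_step _ n (take (i * L.+1) w) (B i)
  (take (d - L) (drop L W)) w (drop L (drop d W))).
- exact/HL/sB.
- rewrite -size_eq0 size_takel ?subn_eq0 -?ltnNge//.
  by rewrite size_drop leq_sub2r// (leq_trans _ (ltnW sW))// leq_addr.
- rewrite [in X in _ = _ ++ _ ++ _ ++ X]eB EW cat_take_drop.
  have -> : drop d W = drop (d - L) (drop L W) by rewrite drop_drop subnK// ltnW.
  by rewrite cat_take_drop /B cat_take_drop cat_take_drop.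
Qed.

Lemma zimin_unavoidable_bool n q :
  exists L, `[< all_words_contain_zimin n q L >].
Proof. by have [L HL] := zimin_unavoidable n q; exists L; apply/asboolP. Qed.

Definition f (n q : nat) : nat := ex_minn (zimin_unavoidable_bool n q).

Lemma fP n q : all_words_contain_zimin n q (f n q) /\
  forall L, all_words_contain_zimin n q L -> f n q <= L.
Proof.
rewrite /f; case: ex_minnP => m /asboolP Hm min; split=> // L HL.
exact/min/asboolP.
Qed.

(* Main.v *)
Require Import Defs.
From mathcomp Require Import all_boot all_order all_algebra.
From mathcomp Require Import boolp classical_sets reals topology normedtype.
From mathcomp Require Import sequences exp.
From mathcomp Require Import lra.
Import Order.TTheory GRing.Theory Num.Theory.
Import numFieldNormedType.Exports.
Local Open Scope classical_set_scope.
Local Open Scope ring_scope.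

(* Split the alphabet into [s] groups of [K + 1] letters, and let the word be a
   sequence of segments, the [t]-th of which is a permutation of the group
   number [t mod s].  For the group [g] the permutation is chosen by the residue
   of [t] modulo a number [period K g], these moduli being pairwise coprime and
   greater than [K!].  An occurrence of [Z_3] yields two occurrences of a factor
   [x v x] with [x] a letter; the factor contains [s - 1] complete consecutive
   segments, hence determines [t] modulo [s - 1] of the moduli, hence its own
   position if the word is at most [(K!) ^ (s - 1)] long.  So
   [f(3, q) > (K!) ^ (s - 1)] whenever [s (K + 1) <= q] and [2 <= s <= K], and
   [s] is let to infinity slowly. *)

Section Word.
Local Open Scope nat_scope.
Set Implicit Arguments.
Unset Strict Implicit.

(** * Permutations selected by number *)

(** Permutations are numbered by their place in the library's enumeration, so that a residue below
    k! can select one. *)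
Definition perm_entry (k a c : nat) : nat :=
  nth 0 (nth [::] (permutations (iota 0 k)) a) c.

Lemma size_permutations_iota k : size (permutations (iota 0 k)) = k`!.
Proof. by rewrite size_permutations ?iota_uniq// size_iota. Qed.

Lemma perm_entry_perm k a : a < k`! ->
  perm_eq (nth [::] (permutations (iota 0 k)) a) (iota 0 k).
Proof.
by move=> ak; rewrite -mem_permutations mem_nth// size_permutations_iota.
Qed.

Lemma perm_entry_lt k a c : a < k`! -> c < k -> perm_entry k a c < k.
Proof.
move=> /perm_entry_perm pk ck.
have : perm_entry k a c \in iota 0 k.
  by rewrite -(perm_mem pk) mem_nth// (perm_size pk) size_iota.
by rewrite mem_iota.
Qed.

Lemma perm_entry_inj k a c c' : a < k`! -> c < k -> c' < k ->
  perm_entry k a c = perm_entry k a c' -> c = c'.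
Proof.
move=> /perm_entry_perm pk ck c'k /eqP.
rewrite nth_uniq ?(perm_size pk) ?size_iota//.
  by move/eqP.
by rewrite (perm_uniq pk) iota_uniq.
Qed.

Lemma perm_index_inj k a b : a < k`! -> b < k`! ->
  (forall c, c < k -> perm_entry k a c = perm_entry k b c) -> a = b.
Proof.
move=> ak bk e.
have /eqP : nth [::] (permutations (iota 0 k)) a =
    nth [::] (permutations (iota 0 k)) b.
  apply: (@eq_from_nth _ 0).
    by rewrite (perm_size (perm_entry_perm ak)) (perm_size (perm_entry_perm bk)).
  by move=> c; rewrite (perm_size (perm_entry_perm ak)) size_iota => /e.
by rewrite nth_uniq ?size_permutations_iota ?permutations_uniq// => /eqP.
Qed.

(** * Coprime moduli and Chinese remaindering *)

(* The moduli of Goedel's beta function: for [g < K] they are pairwise coprime,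
   and they do not exceed the number of permutations of [K.+1] letters. *)
Definition period (K g : nat) : nat := K`! * g.+1 + 1.

(** The two moduli differ by K! (h - g). The first is coprime to K!, and h - g, being positive and
    at most K, divides K!. *)
Lemma coprime_period K g h : g < K -> h < K -> g != h ->
  coprime (period K g) (period K h).
Proof.
wlog gh : g h / g < h.
  move=> W gK hK; rewrite neq_ltn => /orP[gh|hg].
    by apply: W => //; rewrite neq_ltn gh.
  by rewrite coprime_sym; apply: W => //; rewrite neq_ltn hg.
move=> gK hK _; have pE : period K h = period K g + K`! * (h - g).
  by rewrite /period addnAC -mulnDr addSn subnKC// ltnW.
have co : coprime (period K g) K`!.
  by rewrite /coprime gcdnC /period mulnC gcdnMDl gcdn1.
rewrite pE /coprime gcdnDl -/(coprime _ _) coprimeMr co.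
apply: coprime_dvdr co; rewrite dvdn_fact// subn_gt0 gh.
exact: leq_trans (leq_subr g h) (ltnW hK).
Qed.

Lemma period_le_fact K s g : s <= K -> g < s -> period K g <= K.+1`!.
Proof.
move=> sK gs; rewrite factS mulSn /period [leqLHS]addnC leq_add ?fact_gt0//.
by rewrite [leqLHS]mulnC leq_mul2r (leq_trans gs sK) orbT.
Qed.

(* Chinese remaindering over all the moduli but one. *)
Lemma eq_mod_periods K s g0 t t' : s <= K -> g0 < s ->
  (forall g, g < s -> g != g0 -> t = t' %[mod period K g]) ->
  t < K`! ^ s.-1 -> t' < K`! ^ s.-1 -> t = t'.
Proof.
wlog tt' : t t' / t <= t'.
  move=> W sK g0s e tM t'M; have /orP[] := leq_total t t' => h; first exact: W.
  by apply/esym/W => // g gs ne; rewrite e.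
move=> sK g0s e tM t'M; apply/eqP; rewrite eqn_leq tt' -subn_eq0.
have : \prod_(g <- iota 0 s | g != g0) period K g %| t' - t.
  apply/unstable.Gauss_dvd_prod => [|g]; last first.
    rewrite mem_iota => gs ne; rewrite -eqn_mod_dvd//; apply/eqP/esym; exact: e.
  rewrite pairwise_map; have : uniq [seq g <- iota 0 s | g != g0].
    by rewrite filter_uniq ?iota_uniq.
  rewrite uniq_pairwise; apply: (@sub_in_pairwise _ (fun g => g < s)).
    move=> g h gs hs; apply: coprime_period.
      exact: leq_trans gs sK.
    exact: leq_trans hs sK.
  by apply/allP => g; rewrite mem_filter mem_iota => /andP[].
(* A nonzero difference would be at least the product, which has s - 1 factors, each above K!. *)
apply: contraTT; rewrite -lt0n => d0; rewrite gtnNdvd//.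
apply: leq_ltn_trans (leq_subr _ _) _; apply: leq_trans t'M _.
have -> : K`! ^ s.-1 = \prod_(g <- iota 0 s | g != g0) K`!.
  rewrite big_const_seq iter_muln_1; congr (_ ^ _).
  have := count_predC (pred1 g0) (iota 0 s).
  by rewrite size_iota -/(count_mem g0 _) count_uniq_mem ?iota_uniq// mem_iota g0s
    => /(congr1 predn) <-.
by apply: leq_prod => g _; rewrite /period mulnS -addnA leq_addr.
Qed.

(** * The word and its recurring factors *)

(* Group [g] consists of the letters [g * K.+1, ..., g * K.+1 + K]. *)
Definition letter (s K i : nat) : nat :=
  let g := i %/ K.+1 %% s in
  g * K.+1 + perm_entry K.+1 (i %/ K.+1 %% period K g) (i %% K.+1).

Section Letter.
Variables s K : nat.
Hypotheses (s1 : 1 < s) (sK : s <= K).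
Local Notation k := K.+1.
Local Notation w := (letter s K).
Local Notation seg i := (i %/ k).

Let s0 : 0 < s. Proof. exact: ltnW. Qed.

Let index_lt g t : g < s -> t %% period K g < k`!.
Proof.
move=> gs; apply: leq_trans (period_le_fact sK gs).
by rewrite ltn_mod /period addn1.
Qed.

Let entry_lt i : perm_entry k (seg i %% period K (seg i %% s)) (i %% k) < k.
Proof. by rewrite perm_entry_lt ?index_lt ?ltn_mod. Qed.

Lemma letter_lt i : w i < s * k.
Proof.
apply: (@leq_trans ((seg i %% s).+1 * k)); last by rewrite leq_mul2r ltn_mod s0 orbT.
by rewrite mulSn addnC ltn_add2l.
Qed.

Lemma letter_group i j : w i = w j -> seg i = seg j %[mod s].
Proof.
by move=> /(congr1 (divn^~ k)); 
  rewrite /letter !divnMDl// !(divn_small (entry_lt _)) !addn0.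
Qed.

Lemma letter_entry i j : w i = w j ->
  perm_entry k (seg i %% period K (seg i %% s)) (i %% k) =
  perm_entry k (seg j %% period K (seg j %% s)) (j %% k).
Proof.
by move=> /(congr1 (modn^~ k)); rewrite /letter !modnMDl !(modn_small (entry_lt _)).
Qed.

Lemma letter_seg_inj i j : seg i = seg j -> w i = w j -> i = j.
Proof.
move=> e /letter_entry; rewrite e => /perm_entry_inj r.
by rewrite (divn_eq i k) (divn_eq j k) e r ?index_lt ?ltn_mod.
Qed.

(** A segment repeats no letter, so equal letters lie in distinct segments of one group, and the
    numbers of these differ by a multiple of [s]. *)
Lemma letter_return i L : 0 < L -> w i = w (i + L) -> (seg i + s) * k <= i + L.
Proof.
move=> L0 e; rewrite -leq_divRL//.
have le : seg i <= seg (i + L) by rewrite leq_div2r ?leq_addr.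
have ne : seg i != seg (i + L).
  apply/negP => /eqP /letter_seg_inj/(_ e)/eqP.
  by rewrite -[X in X == _]addn0 eqn_add2l eq_sym (gtn_eqF L0).
have /eqP := letter_group e; rewrite eq_sym eqn_mod_dvd// => /dvdn_leq.
by rewrite subn_gt0 ltn_neqAle ne le => /(_ isT); rewrite leq_subRL.
Qed.

(* The segment containing [i] ends first, and then the letters belong to
   different groups. *)
Lemma letter_offset i j : seg i = seg j %[mod s] ->
  w (i + (k - i %% k)) = w (j + (k - i %% k)) -> i %% k <= j %% k.
Proof.
move=> e /letter_group; rewrite leqNgt => h; apply/negP => lt; move: h.
have ik : i %% k <= k by rewrite ltnW// ltn_mod.
have -> : seg (i + (k - i %% k)) = (seg i).+1.
  by rewrite {1}(divn_eq i k) -addnA subnKC// -mulSnr mulnK.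
have -> : seg (j + (k - i %% k)) = seg j.
  have lt_k : j %% k + (k - i %% k) < k.
    by rewrite -[ltnRHS](subnKC ik) ltn_add2r.
  by rewrite {1}(divn_eq j k) -addnA divnMDl// (divn_small lt_k) addn0.
rewrite -addn1 -modnDml e modnDml => /eqP.
by rewrite -[X in _ == X %[mod _]]addn0 eqn_modDl mod0n modn_small.
Qed.

Lemma letter_return_inj i j L : 0 < L -> w i = w (i + L) ->
  (forall d, d <= L -> w (i + d) = w (j + d)) ->
  i < K`! ^ s.-1 -> j < K`! ^ s.-1 -> i = j.
Proof.
move=> L0 wL wd iM jM.
have ret := letter_return L0 wL.
have wij : w i = w j by have := wd 0 isT; rewrite !addn0.
have sij := letter_group wij.
(* The window reaches past the end of the segment of [i], where [letter_offset] compares the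
   alignments. *)
have near d : d <= k - i %% k -> d <= L.
  move=> /leq_trans; apply; rewrite -(leq_add2l i); apply: leq_trans ret.
  rewrite {1}(divn_eq i k) -addnA subnKC ?(ltnW (ltn_pmod _ _))//.
  by rewrite -mulSnr leq_mul2r -[ltnLHS]addn0 ltn_add2l s0 orbT.
(* Once [le] is known, the segment of [j] ends no later than that of [i], so the symmetric
   comparison also stays in the window. *)
have rij : i %% k = j %% k.
  have le : i %% k <= j %% k by apply: letter_offset => //; exact/wd/near.
  apply/eqP; rewrite eqn_leq le; apply: letter_offset => //.
  by apply/esym/wd/near; rewrite leq_sub2l.
suff e : seg i = seg j by exact: letter_seg_inj.
apply: (@eq_mod_periods K s (seg i %% s)) => //; rewrite ?ltn_mod//; last 2 first.
- exact: leq_ltn_trans (leq_div _ _) iM.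
- exact: leq_ltn_trans (leq_div _ _) jM.
move=> g gs ne.
(* The next segment of group [g] is [e] segments ahead; as 0 < e < s, the window contains all of
   it. *)
have [e [es e0 eg]] : exists e, [/\ e < s, 0 < e & (seg i + e) %% s = g].
  exists ((g + (s - seg i %% s)) %% s); split.
  - by rewrite ltn_mod.
  - rewrite lt0n; apply: contra ne => /eqP h.
    have : g + (s - seg i %% s) + seg i %% s = seg i %% s %[mod s].
      by rewrite -modnDml h add0n.
    by rewrite -addnA subnK ?(ltnW (ltn_pmod _ _))// modnDr modn_mod
      modn_small// => ->.
  - rewrite modnDmr -modnDml addnC -addnA subnK ?(ltnW (ltn_pmod _ _))//.
    by rewrite modnDr modn_small.
have eg' : (seg j + e) %% s = g by rewrite -modnDml -sij modnDml.
suff /eqP : (seg i + e) %% period K g = (seg j + e) %% period K g.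
  by rewrite eqn_modDr => /eqP.
apply: (@perm_index_inj k) => [||c ck]; rewrite ?index_lt//.
(* This offset leads to entry [c] of the segment [e] places ahead; the subtraction does not truncate
   because e > 0. *)
have pos h : h %% k = i %% k -> h + (e * k + c - i %% k) = (seg h + e) * k + c.
  move=> hr; rewrite {1}(divn_eq h k) hr -addnA subnKC ?mulnDl ?addnA//.
  apply: leq_trans (leq_addr _ _); apply: leq_trans (leq_pmull _ e0).
  by rewrite ltnW ?ltn_mod.
have : w (i + (e * k + c - i %% k)) = w (j + (e * k + c - i %% k)).
  apply: wd; rewrite -(leq_add2l i) pos//; apply: leq_trans ret.
  apply: ltnW; apply: (@leq_trans ((seg i + e).+1 * k)).
    by rewrite mulSnr ltn_add2l.
  by rewrite leq_mul2r ltn_add2l es orbT.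
move=> /letter_entry; rewrite !pos// !divnMDl// (divn_small ck) !addn0.
by rewrite !modnMDl (modn_small ck) eg eg'.
Qed.

End Letter.

(** * The factorial lower bound *)

Lemma nth_cat_shift (T : Type) (x0 : T) (a u b : seq T) d : d < size u ->
  nth x0 (a ++ u ++ b) (size a + d) = nth x0 u d.
Proof. by move=> du; rewrite nth_cat ltnNge leq_addr/= addKn nth_cat du. Qed.

Lemma lt_f3 s K q : 1 < s -> s <= K -> s * K.+1 <= q -> K`! ^ s.-1 < f 3 q.
Proof.
move=> s1 sK; case: q => [|q] skq.
  by move: skq; rewrite leqn0 muln_eq0 orbF => /eqP s0; rewrite s0 in s1.
rewrite ltnNge; apply/negP => fM.
pose W := mkseq (fun i => inord (letter s K i) : 'I_q.+1) (f 3 q.+1).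
have [h [h0 /infixP[a [b WE]]]] := (fP 3 q.+1).1 W (size_mkseq _ _).
(* Z_3 is read as X c X with X = u v u: two occurrences of [X], in which the first letter of [u]
   returns after |u| + |v| places. *)
pose u := h 1; pose v := h 2; pose c := h 3; pose X := u ++ v ++ u.
have {}WE : W = a ++ X ++ c ++ X ++ b by rewrite WE /= cats0 -!catA.
have u0 : 0 < size u by rewrite lt0n size_eq0 h0.
have WE' : W = (a ++ X ++ c) ++ X ++ b by rewrite WE -!catA.
have val_nth p : p < size W -> nat_of_ord (nth ord0 W p) = letter s K p.
  rewrite size_mkseq => pW; rewrite nth_mkseq// inordK//.
  exact: leq_trans (letter_lt s1 sK p) skq.
pose i := size a; pose j := size (a ++ X ++ c).
have jW : j + size X <= size W.
  by rewrite /j WE' [leqRHS]size_cat leq_add2l (size_cat X) leq_addr.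
have ij : i < j.
  by rewrite /j !size_cat -[ltnLHS]addn0 ltn_add2l -addnA addn_gt0 u0.
have ltW p : p < size X -> (i + p < size W) * (j + p < size W).
  move=> pX; have pj : j + p < size W by apply: leq_trans jW; rewrite ltn_add2l.
  by split=> //; apply: leq_ltn_trans pj; rewrite leq_add2r ltnW.
have Wi p : p < size X -> letter s K (i + p) = nat_of_ord (nth ord0 X p).
  by move=> pX; rewrite -val_nth ?(ltW p pX)// WE nth_cat_shift.
have Wj p : p < size X -> letter s K (j + p) = nat_of_ord (nth ord0 X p).
  by move=> pX; rewrite -val_nth ?(ltW p pX)// WE' nth_cat_shift.
have LX : size u + size v < size X.
  by rewrite /X !size_cat addnA -[ltnLHS]addn0 ltn_add2l.
have X0 : 0 < size X := leq_ltn_trans (leq0n _) LX.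
have lM p : p < size W -> p < K`! ^ s.-1.
  by rewrite size_mkseq => /leq_trans; apply.
suff : i = j by move=> e; rewrite e ltnn in ij.
apply: (@letter_return_inj _ _ s1 sK _ _ (size u + size v)).
- by rewrite addn_gt0 u0.
- rewrite Wi// -[i]addn0 Wi// /X nth_cat u0 catA.
  by rewrite nth_cat size_cat ltnn subnn.
- by move=> d dL; rewrite Wi ?Wj// (leq_ltn_trans dL).
- by apply: lM; have [] := ltW _ X0; rewrite addn0.
- by apply: lM; have [_] := ltW _ X0; rewrite addn0.
Qed.

End Word.

(** * Logarithmic estimates *)

Lemma f3_gt0 q : (0 < f 3 q)%N.
Proof.
rewrite lt0n; apply/negP => /eqP f0.
have [h [h0 /infixP[a [b]]]] := (fP 3 q).1 [::] (esym f0).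
move=> /(congr1 size); rewrite /= !size_cat => /eqP.
rewrite eq_sym !addn_eq0 => /and3P[_ /andP[]].
by rewrite size_eq0 (negbTE (h0 1%N isT)).
Qed.

(** A weak Stirling bound, n! >= (n / e)^n; the induction step rests on ln (1 + x) <= x at x = 1 /
    (n + 1). *)
Lemma ln_fact_ge (R : realType) n :
  n%:R * (ln n%:R - 1) <= ln (n`!)%:R :> R.
Proof.
elim: n => [|[|n] IH]; first by rewrite mul0r ln1.
  by rewrite ln1 mul1r sub0r lerN10.
rewrite factS natrM lnM ?posrE ?ltr0n ?fact_gt0//.
have lnS : ln n.+2%:R - ln n.+1%:R <= n.+1%:R^-1 :> R.
  rewrite -ln_div ?posrE ?ltr0n// -addn1 natrD mulrDl divff ?pnatr_eq0// mul1r.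
  by apply: le_ln1Dx; apply: lt_trans (_ : 0 < _); rewrite ?ltrN10// invr_gt0 ltr0n.
have {}lnS : n.+1%:R * (ln n.+2%:R - ln n.+1%:R) <= 1 :> R.
  by rewrite mulrC -ler_pdivlMr ?ltr0n// mul1r.
have e : n.+2%:R = n.+1%:R + 1 :> R by rewrite natr1.
move: lnS IH; rewrite [X in _ -> _ -> X * _ <= _]e.
by move: {e} n.+1%:R (ln _) (ln _) (ln _) => m x y z; nra.
Qed.

Lemma ln_f3_ge (R : realType) s K q : (1 < s)%N -> (s <= K)%N ->
  (s * K.+1 <= q)%N ->
  (s%:R - 1) * (K%:R * (ln K%:R - 1)) <= ln (f 3 q)%:R :> R.
Proof.
move=> s1 sK skq; apply: (@le_trans _ _ ((s%:R - 1) * ln (K`!)%:R)).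
  by rewrite ler_wpM2l ?ln_fact_ge// subr_ge0 ler1n ltnW.
have -> : (s%:R - 1) * ln (K`!)%:R = ln (K`! ^ s.-1)%N%:R :> R.
  rewrite natrX lnXn ?ltr0n ?fact_gt0// -[RHS]mulr_natl; congr (_ * _).
  by rewrite -{1}(ltn_predK s1) -natr1 addrK.
rewrite ler_ln ?posrE ?ltr0n ?expn_gt0 ?fact_gt0 ?f3_gt0// ler_nat.
exact/ltnW/(lt_f3 s1 sK skq).
Qed.

(* Take [K + 1 = q / s] for a fixed [s] of order [1 / eps]. *)
Lemma ln_f3_asymp (R : realType) (eps : R) : 0 < eps ->
  \forall q \near \oo, (1 - eps) * (q%:R * ln q%:R) <= ln (f 3 q)%:R.
Proof.
(* Two thirds cover the loss from q to (s - 1) K, the last one that from ln q to ln K - 1. *)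
move=> eps0; pose e := eps / 3; have e0 : 0 < e by rewrite divr_gt0.
have [s [s1 se]] : exists s, (1 < s)%N /\ 1 <= e * s%:R.
  exists (Num.truncn e^-1).+2; split=> //.
  rewrite mulrC -ler_pdivrMr// mul1r; apply: ltW.
  by apply: lt_le_trans (truncnS_gt _) _; rewrite ler_nat.
pose C : R := ln (2 * s%:R) + 1.
near=> q.
(* These thresholds yield in turn s <= K, q <= 2 s K, 2 s <= e q, C <= ln q and C <= e ln q. *)
have q_ge : (s * s.+1 <= q)%N by near: q; exact: nbhs_infty_ge.
have q_4s : (4 * s <= q)%N by near: q; exact: nbhs_infty_ge.
have q_e : 2 * s%:R / e < q%:R by near: q; exact: nbhs_infty_gtr.
have q_C : expR C < q%:R by near: q; exact: nbhs_infty_gtr.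
have q_Ce : expR (C / e) < q%:R by near: q; exact: nbhs_infty_gtr.
have s0 : (0 < s)%N by exact: ltnW.
have q0 : 0 < q%:R :> R by apply: lt_trans q_C; exact: expR_gt0.
have K0 : (s < q %/ s)%N by rewrite leq_divRL// mulnC.
pose K := (q %/ s).-1; have KE : (K.+1 = q %/ s)%N by rewrite (ltn_predK K0).
have sK : (s <= K)%N by rewrite -ltnS KE.
have skq : (s * K.+1 <= q)%N by rewrite KE mulnC leq_divM.
have qsK : (q < s * K.+2)%N by rewrite KE mulnC ltn_ceil.
apply: le_trans (ln_f3_ge R s1 sK skq).
have S1 : 1 < s%:R :> R by rewrite ltr1n.
have x4 : 4 * s%:R <= q%:R :> R by rewrite -natrM ler_nat.
have xK : q%:R <= s%:R * (K%:R + 2) :> R.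
  by rewrite -natrD -natrM ler_nat addn2 ltnW.
have Kx : s%:R * K%:R <= q%:R :> R.
  by rewrite -natrM ler_nat (leq_trans _ skq)// leq_mul2l leqnSn orbT.
have xe : 2 * s%:R <= e * q%:R by rewrite [leRHS]mulrC -ler_pdivrMr// ltW.
have lC : C <= ln q%:R by rewrite -[C]expRK ler_ln ?posrE ?expR_gt0// ltW.
have lCe : C <= e * ln q%:R.
  by rewrite mulrC -ler_pdivrMr// -[C / e]expRK ler_ln ?posrE ?expR_gt0// ltW.
have K_gt0 : 0 < K%:R :> R by rewrite ltr0n (leq_trans s0).
have C0 : 0 <= C.
  by rewrite addr_ge0// ln_ge0// -natrM ler1n muln_gt0.
have S2 : 0 < 2 * s%:R :> R by rewrite mulr_gt0 ?ltr0n.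
have lK : ln q%:R - C <= ln K%:R - 1.
  suff : ln q%:R <= ln (2 * s%:R) + ln K%:R :> R by rewrite /C; lra.
  by rewrite -lnM ?posrE// ler_ln ?posrE ?(mulr_gt0 S2)//; nra.
have epsE : eps = 3 * e by rewrite /e; lra.
have ke : K%:R <= e * q%:R by nra.
(* Here s K >= q - 2 s, and both 2 s and K are at most e q. *)
pose B : R := (s%:R - 1) * K%:R.
have Bge : (1 - 2 * e) * q%:R <= B by rewrite /B; nra.
have Ble : B <= q%:R by rewrite /B; nra.
have B0 : 0 <= B by rewrite mulr_ge0// subr_ge0 ltW.
rewrite [leRHS]mulrA -/B; apply: (@le_trans _ _ (B * (ln q%:R - C))); last first.
  by rewrite ler_wpM2l.
have l0 : 0 <= ln q%:R :> R by exact: le_trans C0 lC.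
have h1 : (1 - 2 * e) * q%:R * ln q%:R <= B * ln q%:R by rewrite ler_wpM2r.
have h2 : B * C <= q%:R * (e * ln q%:R) by rewrite ler_pM.
by rewrite epsE; nra.
Unshelve. all: by end_near.
Qed.

(** * The exponent *)

Lemma powR_le_f3 (R : realType) q (y : R) : (2 <= q)%N ->
  y <= ln (f 3 q)%:R / ln q%:R -> q%:R `^ y <= (f 3 q)%:R.
Proof.
move=> q2 yle; have q0 : 0 < q%:R :> R by rewrite ltr0n ltnW.
have l0 : 0 < ln q%:R :> R by rewrite ln_gt0// ltr1n.
rewrite -ler_ln ?posrE ?(powR_gt0 _ q0) ?ltr0n ?f3_gt0//.
by rewrite ln_powR -ler_pdivlMr.
Qed.

Theorem theorem3p2 (R : realType) :
  exists g : nat -> R,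
    (fun q : nat => g q / q%:R) @ \oo --> (0 : R) /\
    forall q : nat, (2 <= q)%N -> q%:R `^ (q%:R - g q) <= (f 3 q)%:R.
Proof.
(* The deficit of log_q f(3, q) below q, cut off at 0 so that a lower bound on [f 3 q] suffices for
   the limit. *)
exists (fun q => Num.max 0 (q%:R - ln (f 3 q)%:R / ln q%:R)); split; last first.
  move=> q q2; apply: powR_le_f3 => //.
  by rewrite lerBlDr -lerBlDl le_max lexx orbT.
apply/cvgr0Pnorm_le => eps eps0; near=> q.
have q1 : (1 < q)%N by near: q; exact: nbhs_infty_ge.
have q0 : 0 < q%:R :> R by rewrite ltr0n ltnW.
have l0 : 0 < ln q%:R :> R by rewrite ln_gt0// ltr1n.
have h : (1 - eps) * (q%:R * ln q%:R) <= ln (f 3 q)%:R.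
  by near: q; exact: ln_f3_asymp.
rewrite ger0_norm; last by rewrite divr_ge0 ?le_max ?lexx// ltW.
rewrite ler_pdivrMr// ge_max mulr_ge0 ?(ltW eps0) ?(ltW q0)//=.
rewrite lerBlDr -lerBlDl ler_pdivlMr//; apply: le_trans h.
by lra.
Unshelve. all: by end_near.
Qed.
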